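(* Let $a_1,\dots,a_k$ be positive integers with $\sum_{i=1}^k 1/a_i\ge 2$. Then $(a_1,\dots,a_k)$ is good.
   Context: A tuple $(a_1,\dots,a_k)$ of positive integers is good if there are sets $S_1,\dots,S_k\subseteq\mathbb{R}$ such that any two distinct elements of $S_i$ differ by at least $a_i$ and every integer belongs to $S_1\cup\dots\cup S_k$; otherwise it is bad. *)

(* Defs.v *)
From mathcomp Require Import all_boot all_order all_algebra.
From mathcomp Require Import classical_sets reals.
Set Implicit Arguments.
Unset Strict Implicit.
Unset Printing Implicit Defensive.
Import Order.TTheory GRing.Theory Num.Theory.
Local Open Scope classical_set_scope.
Local Open Scope ring_scope.

Definition separated (R : realType) (d : nat) (S : set R) : Prop :=
  forall x y : R, S x -> S y -> x <> y -> d%:R <= `|x - y|.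

Definition good (R : realType) (k : nat) (a : 'I_k -> nat) : Prop :=
  exists S : 'I_k -> set R,
    (forall i : 'I_k, separated (a i) (S i)) /\
    (forall n : int, (\bigcup_(i in [set: 'I_k]) S i) n%:~R).

(* Main.v *)
Require Import Defs.
From mathcomp Require Import all_boot all_order all_algebra.
From mathcomp Require Import classical_sets reals.
From mathcomp Require Import ring.
Import Order.TTheory GRing.Theory Num.Theory.
Local Open Scope ring_scope.

(** Replace each [a i] by a power of two [2 ^ e i] with
    [a i <= 2 ^ e i <= 2 * a i]; the reciprocals then still sum to at least 1.
    Arithmetic progressions whose differences are powers of two can be placed
    greedily in order of increasing difference: the uncovered integers always
    form a union of residue classes modulo the current difference, so each new
    progression fills exactly one of them and no density is wasted. *)

(* [T] lists representatives of the classes modulo [2 ^ m] still to be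
   covered. *)
Lemma greedy_dyadic_cover (R : realFieldType) (I : eqType) (e : I -> nat)
    (s : seq I) (m : nat) (T : seq int) :
  uniq s -> sorted (relpre e leq) s -> {in s, forall i, (m <= e i)%N} ->
  (size T)%:R / 2 ^+ m <= \sum_(i <- s) (2 ^+ e i)^-1 :> R ->
  exists c : I -> int, forall (r q : int), r \in T ->
    exists2 i, i \in s & exists q' : int, r + q * 2 ^+ m = c i + q' * 2 ^+ e i.
Proof.
elim: s m T => [|i s IHs] m T.
  move=> _ _ _; rewrite big_nil pmulr_lle0 ?invr_gt0 ?exprn_gt0 // lern0.
  by move=> /nilP ->; exists (fun=> 0) => r q.
move=> /= /andP[i_notin uniq_s] sorted_is m_le.
rewrite big_cons => size_le.
have m_le_ei : (m <= e i)%N by rewrite m_le ?mem_head.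
have ei_le j : j \in s -> (e i <= e j)%N.
  apply/allP: j; apply: (order_path_min _ sorted_is).
  by move=> x y z; apply: leq_trans.
(* Each class modulo [2 ^ m] splits into [2 ^ (e i - m)] classes modulo [2 ^ e i], so the density
   still to be covered is unchanged. *)
pose T' := [seq r + q%:Z * 2 ^+ m | r <- T, q <- iota 0 (2 ^ (e i - m))].
have size_T' : (size T')%:R / 2 ^+ e i = (size T)%:R / 2 ^+ m :> R.
  rewrite size_allpairs size_iota natrM natrX -{2}(subnK m_le_ei) exprD.
  by field; rewrite !expf_neq0 ?pnatr_eq0.
have T'P (r q : int) : r \in T ->
    exists2 t, t \in T' & exists q' : int,
      r + q * 2 ^+ m = t + q' * 2 ^+ e i.
  move=> rT; pose d : int := 2 ^+ (e i - m).
  have d_gt0 : 0 < d by rewrite exprn_gt0.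
  exists (r + (q %% d)%Z * 2 ^+ m).
    have := modz_ge0 q (lt0r_neq0 d_gt0); have := ltz_pmod q d_gt0.
    case: (q %% d)%Z => // n n_lt _; apply: allpairs_f => //.
    by rewrite mem_iota /= add0n -ltz_nat -(natz (2 ^ _)) natrX.
  exists (q %/ d)%Z; rewrite {1}(divz_eq q d) -{1}(subnK m_le_ei) exprD -/d.
  by ring.
(* An empty [T'] leaves nothing to cover. Otherwise progression [i] takes the class of [t], which
   lowers the remaining density by exactly the term of [i] in the sum. *)
case: T' size_T' T'P => [|t T'] size_T' T'P.
  by exists (fun=> 0) => r q /(T'P _ q)[].
have [|||c cP] := IHs (e i) T' uniq_s.
- exact: path_sorted sorted_is.
- exact: ei_le.
- move: size_le; rewrite -size_T' /= -natr1 mulrDl mul1r addrC.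
  by rewrite lerD2l.
exists (fun j => if j == i then t else c j) => r q /(T'P _ q)[u u_in [q1 ->]].
move: u_in; rewrite inE => /predU1P[->|/(cP _ q1)[j j_in [q2 ->]]].
  by exists i; rewrite ?mem_head // eqxx; exists q1.
exists j; first by rewrite inE j_in orbT.
by rewrite ifN; [exists q2 | apply: contraNneq i_notin => <-].
Qed.

Lemma dyadic_cover (R : realFieldType) (I : finType) (e : I -> nat) :
  1 <= \sum_i (2 ^+ e i)^-1 :> R ->
  exists c : I -> int, forall n : int,
    exists i, exists q : int, n = c i + q * 2 ^+ e i.
Proof.
move=> sum_ge1; pose s := sort (relpre e leq) (index_enum I).
(* The start is a single class modulo [2 ^ 0], which is all of the integers. *)
have [||||c cP] := @greedy_dyadic_cover R I e s 0 [:: 0].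
- by rewrite sort_uniq index_enum_uniq.
- by apply: sort_sorted => x y; apply: leq_total.
- by [].
- by rewrite divr1 (perm_big (index_enum I)) // perm_sort.
exists c => n; have [i _ [q nE]] := cP 0 n (mem_head _ _).
by exists i, q; rewrite -nE add0r mulr1.
Qed.

Lemma separated_progression (R : realType) (d D : nat) (c : int) :
  (d <= D)%N ->
  separated d [set x : R | exists q : int, x = (c + q * D%:R)%:~R]%classic.
Proof.
move=> d_le x y [p ->] [q ->] xy.
rewrite -intrB opprD addrACA subrr add0r -mulrBl intrM normrM.
rewrite mulrz_nat normr_nat.
(* Distinct points have distinct indices, and distinct integers differ by at least 1. *)
have pq : p - q != 0 by apply: contra_not_neq xy => /subr0_eq ->.
have : 1 <= `|(p - q)%:~R| :> R by rewrite -intr_norm ler1z -gtz0_ge1 normr_gt0.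
move=> /(ler_wpM2r (ler0n R D)); rewrite mul1r.
by apply: le_trans; rewrite ler_nat.
Qed.

Theorem theorem6 (R : realType) (k : nat) (a : 'I_k -> nat)
  (a_gt0 : forall i : 'I_k, (0 < a i)%N)
  (sum_ge2 : 2 <= \sum_(i < k) (a i)%:R^-1 :> R) :
  good R a.
Proof.
(* [2 ^ e i] is the least power of two exceeding [a i], so its half is at most [a i] and twice its
   reciprocal is at least that of [a i]. *)
pose e i := (trunc_log 2 (a i)).+1.
have [|c cP] := @dyadic_cover R 'I_k e.
  rewrite -(ler_pM2l (ltr0n R 2)) mulr1 (le_trans sum_ge2) // mulr_sumr.
  apply: ler_sum => i _; rewrite exprS invfM mulVKf ?pnatr_eq0 //.
  rewrite lef_pV2 ?posrE ?exprn_gt0 ?ltr0n // -natrX ler_nat.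
  by have /andP[] := trunc_log_bounds (isT : (1 < 2)%N) (a_gt0 i).
exists (fun i => [set x : R |
  exists q : int, x = (c i + q * (2 ^ e i)%:R)%:~R]%classic).
split=> [i|n].
  apply: separated_progression; apply: ltnW.
  by have /andP[] := trunc_log_bounds (isT : (1 < 2)%N) (a_gt0 i).
by have [i [q ->]] := cP n; exists i => //; exists q; rewrite natrX.
Qed.
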